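(* Let $\Delta$ be a simplicial complex on a finite set $\mathcal{S}$ and let $V=\{v_s\mid s\in\mathcal{S}\}$ be a set of vectors in a real vector space such that $\mathcal{F}(\Delta,V)$ is non-degenerate. For a $\Delta$-building set $\mathcal{B}$, the fan $\mathcal{F}(\Delta,V,\mathcal{B})$ is equal to the coarsest common refinement of the fans $\mathcal{F}(\Delta,V,\mathcal{B}_I)$ for $I\in\mathcal{B}$, where $\mathcal{B}_I$ denotes the $\Delta$-building set consisting of $I$ and all singleton subsets of $\mathcal{S}$.
   Context: A simplicial complex $\Delta$ on $\mathcal{S}$ is a family of subsets of $\mathcal{S}$ closed under taking subsets and containing all singletons. $\operatorname{Cone}(X)$ denotes the set of finite nonnegative linear combinations of elements of $X$ (with $\operatorname{Cone}(\emptyset)=\{0\}$). $\mathcal{F}(\Delta,V)$ is the set of cones $C^V_I=\operatorname{Cone}\{v_s\mid s\in I\}$ for $I\in\Delta$. It is non-degenerate if $C^V_I\cap C^V_{I'}=C^V_{I\cap I'}$ for all $I,I'\in\Delta$ and each $C^V_I$ is $|I|$-dimensional. A $\Delta$-building set is a set $\mathcal{B}$ of nonempty faces of $\Delta$ containing all singletons $\{s\}$, $s\in\mathcal{S}$, such that whenever $S_1,S_2\in\mathcal{B}$, $S_1\cap S_2\neq\emptyset$ and $S_1\cup S_2\in\Delta$, then $S_1\cup S_2\in\mathcal{B}$. A subset $N\subseteq\mathcal{B}$ is $\mathcal{B}$-nested if for any pairwise incomparable $x_1,\dots,x_t\in N$, $t\ge2$, the union $x_1\cup\cdots\cup x_t$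 is in $\Delta$ and not in $\mathcal{B}$. For a $\mathcal{B}$-nested set $N$, let $K^V_N=\operatorname{Cone}\{\sum_{i\in I}v_i\mid I\in N\}$. Then $\mathcal{F}(\Delta,V,\mathcal{B})$ is the collection of cones $K_N^V$ over all $\mathcal{B}$-nested sets $N$ (including $N=\emptyset$). The coarsest common refinement of fans $\mathcal{F}_1,\dots,\mathcal{F}_m$ is the set of cones $\{C_1\cap\cdots\cap C_m\mid C_j\in\mathcal{F}_j\}$. *)

(* Defs.v *)
From HB Require Import structures.
From mathcomp Require Import all_boot all_order all_algebra.
From mathcomp Require Import boolp classical_sets reals.

Set Implicit Arguments.
Unset Strict Implicit.
Unset Printing Implicit Defensive.

Import GRing.Theory Num.Theory.
Local Open Scope ring_scope.

Section Combinatorics.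
Context {S : finType}.
Implicit Types (Delta B N X : {set {set S}}) (I J : {set S}).

Definition simplicial_complex Delta : Prop :=
  (forall I J, J \in Delta -> I \subset J -> I \in Delta) /\
  (forall s : S, [set s]%SET \in Delta).

Definition building_set Delta B : Prop :=
  [/\ forall I, I \in B -> I != finset.set0 /\ I \in Delta,
      forall s : S, [set s]%SET \in B
    & forall I J, I \in B -> J \in B -> I :&: J != finset.set0 ->
        I :|: J \in Delta -> I :|: J \in B].

Definition antichain X : Prop :=
  forall I J, I \in X -> J \in X -> I != J -> ~~ (I \subset J).

(* Pairwise incomparable faces x_1, ..., x_t are distinct, so the list is
   encoded as a set X with #|X| = t; [finset.cover X] is its union. *)
Definition nested Delta B N : Prop :=
  N \subset B /\
  forall X, X \subset N -> (2 <= #|X|)%N -> antichain X ->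
    finset.cover X \in Delta /\ finset.cover X \notin B.

Definition one_face_building I : {set {set S}} :=
  (I |: [set [set s] | s in [set: S]])%SET.

Lemma one_face_buildingP Delta I :
  simplicial_complex Delta -> I != finset.set0 -> I \in Delta ->
  building_set Delta (one_face_building I).
Proof.
move=> [_ D1] I0 ID.
have BI : I \in one_face_building I by apply/setU1P; left.
have B1 s : [set s]%SET \in one_face_building I.
  by apply/setU1P; right; apply/imsetP; exists s.
split=> //.
- move=> J /setU1P[->|/imsetP[s _ ->]]; split=> //.
  by apply/set0Pn; exists s; rewrite inE.
- move=> J K /setU1P[->|/imsetP[s _ ->]] /setU1P[->|/imsetP[t _ ->]];
    move=> /set0Pn[x /finset.setIP[]].
  + by rewrite finset.setUid.
  + move=> xI /set1P <- _; suff -> : (I :|: [set x])%SET = I by [].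
    by apply/finset.setUidPl; rewrite finset.sub1set.
  + move=> /set1P <- xI _; suff -> : ([set x] :|: I)%SET = I by [].
    by apply/finset.setUidPr; rewrite finset.sub1set.
  + by move=> /set1P <- /set1P <- _; rewrite finset.setUid.
Qed.

End Combinatorics.

Section Cones.
Context {R : realType} {E : lmodType R}.
Implicit Types (X : set E).

(* n = 0 is allowed, so that [cone] and [lspan] of the empty set are {0}. *)
Definition cone X : set E :=
  [set w | exists n (c : 'I_n -> R) (x : 'I_n -> E),
     [/\ forall i, 0 <= c i, forall i, X (x i)
       & w = \sum_(i < n) c i *: x i]]%classic.

Definition lspan X : set E :=
  [set w | exists n (c : 'I_n -> R) (x : 'I_n -> E),
     (forall i, X (x i)) /\ w = \sum_(i < n) c i *: x i]%classic.

Definition lin_indep n (b : 'I_n -> E) : Prop :=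
  forall c : 'I_n -> R, \sum_(i < n) c i *: b i = 0 -> forall i, c i = 0.

(* [E] need not be finite-dimensional, hence no [vectType]; the dimension of a
   cone is that of its linear span. *)
Definition has_dim X n : Prop :=
  exists b : 'I_n -> E, lin_indep b /\ lspan (range b) = lspan X.

End Cones.

Section Fans.
Context {S : finType} {R : realType} {E : lmodType R}.
Implicit Types (Delta B N : {set {set S}}) (I J : {set S}) (v : S -> E).

Definition face_cone v I : set E :=
  cone [set v s | s in [set` I]]%classic.

Definition simplicial_fan Delta v : set (set E) :=
  [set face_cone v I | I in [set` Delta]]%classic.

(* A property of the indexed family of cones C_I, and not only of the set
   [simplicial_fan Delta v] of those cones. *)
Definition nondegenerate_family Delta v : Prop :=
  (forall I J, I \in Delta -> J \in Delta ->
     (face_cone v I `&` face_cone v J)%classic = face_cone v (I :&: J)%SET) /\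
  (forall I, I \in Delta -> has_dim (face_cone v I) #|I|).

Definition nested_cone v N : set E :=
  cone [set \sum_(s in I) v s | I in [set` N]]%classic.

Definition nested_fan Delta v B : set (set E) :=
  [set nested_cone v N | N in nested Delta B]%classic.

(* The refinement of the fans [F j], j in A.  For empty A it is
   {[the whole space]}, so it is only meaningful for nonempty A. *)
Definition coarsest_common_refinement (J : finType) (A : {set J})
    (F : J -> set (set E)) : set (set E) :=
  [set D | exists C : J -> set E,
     (forall j, j \in A -> F j (C j)) /\
     D = \bigcap_(j in [set` A]) C j]%classic.

End Fans.

(* Main.v *)
(* Non-degeneracy gives every point of the support of the fan unique coordinates
   [f : S -> R], [f >= 0] with support in [Delta].  For a laminar family [N], a
   point lies in [nested_cone v N] iff [f] vanishes off the union of [N] and is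
   monotone for the preorder "every member of [N] containing [s] contains [t]".
   The theorem thus becomes a comparison of such preorders, which rests on this
   fact: if [N] is [B]-nested, [I] is in [B] and [I] is covered by [N], then some
   [s] in [I] is such that every member of [N] containing [s] contains [I]. *)

Require Import Defs.
From mathcomp Require Import all_boot all_order all_algebra.
From mathcomp Require Import boolp classical_sets reals.

Set Implicit Arguments.
Unset Strict Implicit.
Unset Printing Implicit Defensive.

Import Order.TTheory GRing.Theory Num.Theory.
Local Open Scope ring_scope.

(** * Combinatorics of nested sets and laminar families *)

Section NestedSets.
Context {S : finType}.
Implicit Types (Delta B N X : {set {set S}}) (I J K L M : {set S}).

Definition laminar N : Prop := forall K L, K \in N -> L \in N ->
  K :&: L != finset.set0 -> K \subset L \/ L \subset K.

(** An antichain with the same union as [N]; the condition in [nested] applies to it once it has two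
    members. *)
Definition maximals N : {set {set S}} :=
  [set K in N | [forall L in N, (K \subset L) ==> (K == L)]].

Lemma sub_cover N K : K \in N -> K \subset finset.cover N.
Proof. by move=> KN; rewrite (finset.bigcup_sup K). Qed.

Lemma cover_sub N (U : {set S}) :
  (forall K, K \in N -> K \subset U) -> finset.cover N \subset U.
Proof. by move=> NU; apply/finset.bigcupsP. Qed.

Lemma mem_cover N s :
  reflect (exists2 K : {set S}, K \in N & s \in K) (s \in finset.cover N).
Proof. exact: finset.bigcupP. Qed.

Lemma maximalsP N K : K \in N ->
  exists2 M, M \in maximals N & K \subset M.
Proof.
move=> KN; pose P L := (L \in N) && (K \subset L).
have PK : P K by rewrite /P KN subxx.
case: (@arg_maxnP _ K P (fun L : {set S} => #|L|) PK) => M /andP[MN KM] maxM.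
exists M => //; rewrite inE MN; apply/forall_inP => L LN.
apply/implyP => ML; rewrite eqEcard ML; apply: maxM.
by rewrite /P LN (fintype.subset_trans KM ML).
Qed.

Lemma sub_maximals N : maximals N \subset N.
Proof. by apply/fintype.subsetP => K; rewrite inE => /andP[]. Qed.

Lemma antichain_maximals N : antichain (maximals N).
Proof.
move=> K L; rewrite !inE => /andP[KN /forall_inP maxK] /andP[LN _] KL.
by apply/negP => sKL; move: KL; rewrite (implyP (maxK L LN) sKL).
Qed.

Lemma cover_maximals N : finset.cover (maximals N) = finset.cover N.
Proof.
apply/eqP; rewrite finset.eqEsubset; apply/andP; split; apply: cover_sub => K.
  by move/(fintype.subsetP (sub_maximals N)); apply: sub_cover.
by move=> /maximalsP[M MN KM]; apply: (fintype.subset_trans KM); apply: sub_cover.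
Qed.

(** Two incomparable members form an antichain, so their union is a face outside [B]; if they met,
    the building set axiom would put it in [B]. *)
Lemma nested_laminar Delta B N :
  building_set Delta B -> nested Delta B N -> laminar N.
Proof.
move=> [_ _ BU] [/fintype.subsetP NB nN] K L KN LN KL.
case: (boolP (K \subset L)) => [|nKL]; first by left.
case: (boolP (L \subset K)) => [|nLK]; first by right.
have KneL : K != L by apply: contraNneq nKL => ->.
have [] := nN [set K; L].
- by apply/fintype.subsetP => M /set2P[] ->.
- by rewrite cards2 KneL.
- by move=> P Q /set2P[] -> /set2P[] ->; rewrite ?eqxx.
rewrite /finset.cover finset.big_setU1 ?inE // finset.big_set1 => UD.
by rewrite BU // NB.
Qed.

(** The maximal members have the same union. Nestedness applies to two or more of them; a single one
    is a face because it lies in [B], and none gives the empty face. *)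
Lemma cover_nested Delta B N : finset.set0 \in Delta ->
  building_set Delta B -> nested Delta B N -> finset.cover N \in Delta.
Proof.
move=> D0 [BD _ _] [/fintype.subsetP NB nN]; rewrite -cover_maximals.
have := sub_maximals N; have := @antichain_maximals N.
move: (maximals N) => X aX XN.
case: (ltngtP #|X| 1) => X1.
- move: X1; rewrite ltnS leqn0 cards_eq0 => /eqP ->.
  by rewrite /finset.cover finset.big_set0.
- by case: (nN X XN X1 aX).
- have /cards1P[K XK] : #|X| == 1 by rewrite X1.
  rewrite XK /finset.cover finset.big_set1.
  have KN : K \in N by apply: (fintype.subsetP XN); rewrite XK inE.
  by case: (BD K (NB _ KN)).
Qed.

(** Induction on the size of [X]: members are adjoined one at a time, each meeting [I], and the
    partial unions are faces because the full union is. *)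
Lemma building_setU_cover Delta B I X : simplicial_complex Delta ->
  building_set Delta B -> I \in B -> X \subset B ->
  (forall K, K \in X -> K :&: I != finset.set0) ->
  I :|: finset.cover X \in Delta -> I :|: finset.cover X \in B.
Proof.
move=> [D1 _] [_ _ BU] IB; move eqn : #|X| => n.
elim: n X eqn => [|n IH] X cX XB XI UD.
  move/eqP: cX; rewrite cards_eq0 => /eqP ->.
  by rewrite /finset.cover finset.big_set0 finset.setU0.
have /set0Pn[K KX] : X != finset.set0 by rewrite -card_gt0 cX.
have eqX : I :|: finset.cover X = (I :|: finset.cover (X :\ K)) :|: K.
  by rewrite /finset.cover (finset.big_setD1 K KX) /= (finset.setUC K)
     finset.setUA.
have sub : X :\ K \subset X by rewrite subD1set.
rewrite eqX; apply: BU.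
- apply: IH; first by move: cX; rewrite (cardsD1 K) KX => -[].
  + exact: fintype.subset_trans XB.
  + by move=> L LX; apply: XI; apply: (fintype.subsetP sub).
  + by apply: D1 UD _; rewrite eqX finset.subsetUl.
- exact: (fintype.subsetP XB).
- have /set0Pn[x /finset.setIP[xK xI]] := XI _ KX.
  by apply/set0Pn; exists x; rewrite !inE xK xI.
- by rewrite -eqX.
Qed.

(* Otherwise [I] is covered by the members of [N] which meet but do not contain
   it; at least two of these are maximal, and their union lies in [B]. *)
Lemma nested_core Delta B N I : simplicial_complex Delta ->
  building_set Delta B -> nested Delta B N -> I \in B ->
  I \subset finset.cover N ->
  exists2 s, s \in I & forall K, K \in N -> s \in K -> I \subset K.
Proof.
move=> cD bB nN IB IN.
have [BD _ _] := bB; have [I0 ID] := BD I IB.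
have [NB nX] := nN.
have D0 : finset.set0 \in Delta by case: cD => D1 _; apply: D1 ID (finset.sub0set _).
apply: contrapT => noS.
pose Y := [set K in N | ~~ (I \subset K) && (K :&: I != finset.set0)].
have IY : I \subset finset.cover Y.
  apply/fintype.subsetP => s sI; apply: contrapT => sY; apply: noS.
  exists s => // K KN sK; apply: contrapT => /negP IK; apply: sY.
  apply/mem_cover; exists K => //; rewrite inE KN IK /=.
  by apply/set0Pn; exists s; rewrite inE sK.
have YN : maximals Y \subset N.
  by apply: fintype.subset_trans (sub_maximals _) _; apply/fintype.subsetP => K;
    rewrite inE => /andP[].
have inY K : K \in maximals Y -> K \in Y
  by apply: (fintype.subsetP (sub_maximals _)).
have IUY : I :|: finset.cover (maximals Y) = finset.cover (maximals Y).
  by rewrite cover_maximals; apply/finset.setUidPr.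
(* A single maximal member would contain all of [I], which the choice of [Y] excludes. *)
have Y2 : (2 <= #|maximals Y|)%N.
  have /set0Pn[s sI] := I0.
  have /mem_cover[K KY sK] := fintype.subsetP IY s sI.
  have [M MY KM] := maximalsP KY.
  rewrite (cardsD1 M) MY ltnS card_gt0; apply/negP => /eqP Y0.
  have YM : maximals Y = [set M] by rewrite -(finset.setD1K MY) Y0 finset.setU0.
  have := inY _ MY; rewrite inE => /and3P[_ /negP nIM _]; apply: nIM.
  by move: IY; rewrite -cover_maximals YM /finset.cover finset.big_set1.
have [UD] := nX _ YN Y2 (@antichain_maximals Y).
rewrite -IUY => /negP; apply; apply: building_setU_cover cD bB IB _ _ _.
- exact: fintype.subset_trans NB.
- by move=> K /inY; rewrite inE => /and3P[].
- by rewrite IUY.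
Qed.

Definition dominated N (s t : S) : Prop :=
  forall K, K \in N -> s \in K -> t \in K.

End NestedSets.

(** * Coordinate functions adapted to a family of sets *)

Section Coordinates.
Context {S : finType} {R : realType}.
Implicit Types (Delta B N X : {set {set S}}) (I J K L M : {set S}).
Implicit Types (f : S -> R).

(** For laminar [N], these conditions cut out the nonnegative combinations of indicator functions of
    members of [N]. *)
Definition adapted N f : Prop :=
  [/\ forall s, 0 <= f s, forall s, s \notin finset.cover N -> f s = 0
    & forall s t, dominated N s t -> f s <= f t].

Lemma adapted_sum N (a : {set S} -> R) : (forall K, 0 <= a K) ->
  adapted N (fun s => \sum_(K in N) a K *+ (s \in K)).
Proof.
move=> a0; split=> [s|s sN|s t st].
- by apply: sumr_ge0 => K _; rewrite mulrn_wge0.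
- apply: big1 => K KN; case: (boolP (s \in K)) => // sK.
  by move: sN; rewrite (fintype.subsetP (sub_cover KN)).
- apply: ler_sum => K KN; case: (boolP (s \in K)) => sK.
    by rewrite (st K KN sK).
  by rewrite mulr0n mulrn_wge0.
Qed.

(* Peel off a largest member [M]: subtracting the minimum of [f] on [M] leaves
   a function adapted to [N :\ M]. *)
Lemma laminar_adapted_sum N f : laminar N -> adapted N f ->
  exists2 a : {set S} -> R, forall K, 0 <= a K &
    forall s, f s = \sum_(K in N) a K *+ (s \in K).
Proof.
move eqn : #|N| => n; elim: n N f eqn => [|n IH] N f cN lN [f0 fN fM].
  exists (fun=> 0) => // s; move/eqP: cN; rewrite cards_eq0 => /eqP N0.
  rewrite N0 finset.big_set0 fN // N0.
  by apply/negP => /mem_cover[K]; rewrite inE.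
have /set0Pn[K0 K0N] : N != finset.set0 by rewrite -card_gt0 cN.
case: (@arg_maxnP _ K0 (mem N) (fun L : {set S} => #|L|) K0N) => M /= MN maxM.
have {}MN : M \in N by [].
have subM K : K \in N -> K :&: M != finset.set0 -> K \subset M.
  move=> KN /(lN _ _ KN MN)[//|MK].
  by have /eqP <- : M == K by rewrite eqEcard MK; exact: maxM.
pose N' := N :\ M.
have domM s t : s \in M -> s \notin finset.cover N' -> t \in M ->
    dominated N s t.
  move=> sM sN' tM K KN sK; case: (eqVneq K M) => [->//|KM].
  by case/mem_cover: sN'; exists K => //; rewrite !inE KM.
(* If some points of [M] lie in no other member of [N], then [f] is constant on them and takes its
   minimum over [M] there. If there are none, [m = 0] works, as the other members cover [M]. *)
have [m [m0 mle meq]] : exists m, [/\ 0 <= m, forall t, t \in M -> m <= f t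
    & forall s, s \in M -> s \notin finset.cover N' -> f s = m].
  case: (pickP (fun s => (s \in M) && (s \notin finset.cover N'))).
    move=> s0 /andP[s0M s0N']; exists (f s0); split=> //.
      by move=> t tM; apply: fM; apply: domM.
    by move=> s sM sN'; apply/eqP; rewrite eq_le !fM //; apply: domM.
  move=> no; exists 0; split=> // s sM sN'.
  by have := no s; rewrite sM sN'.
pose f' s := f s - m *+ (s \in M).
have f'0 s : s \notin finset.cover N' -> f' s = 0.
  move=> sN'; rewrite /f'; case: (boolP (s \in M)) => sM.
    by rewrite (meq s) // mulr1n subrr.
  rewrite mulr0n subr0; apply: fN; apply/negP => /mem_cover[K KN sK].
  case/mem_cover: sN'; exists K => //; rewrite !inE KN andbT.
  by apply: contraNneq sM => <-.
have f'ge s : 0 <= f' s.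
  by rewrite /f'; case: (boolP (s \in M)) => sM;
    rewrite ?mulr1n ?mulr0n ?subr0 // subr_ge0 mle.
have [||//|a a0 fa] := IH N' f'.
- by move: cN; rewrite (cardsD1 M) MN => -[].
- by move=> K L /setD1P[_ KN] /setD1P[_ LN]; apply: lN.
- split=> // s t st; case: (boolP (s \in finset.cover N')) => [|sN'].
    case/mem_cover => K KN' sK; have tK := st K KN' sK.
    have /setD1P[KM KN] := KN'.
    (* [K] meets [M] only if it lies inside it, so [s] and [t] are both in [M] or both outside, and
       the same amount is subtracted from both values. *)
    have MM : (s \in M) = (t \in M).
      by apply/idP/idP => iM; apply: (fintype.subsetP (subM K KN _)) => //;
        apply/set0Pn; [exists s|exists t]; rewrite inE ?sK ?tK.
    rewrite /f' MM lerD2r; apply: fM => L LN sL.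
    case: (eqVneq L M) => [LM|LM]; first by rewrite LM -MM -LM.
    by apply: st => //; rewrite !inE LM.
  by rewrite f'0.
exists (fun K => if K == M then m else a K) => [K|s]; first by case: ifP.
rewrite (finset.big_setD1 M MN) /= eqxx.
rewrite (eq_bigr (fun K => a K *+ (s \in K))); last first.
  by move=> K /setD1P[/negbTE ->].
by rewrite -fa /f' addrC subrK.
Qed.

(** [NI I] consists of [I], if [N] covers it, and of the singletons of covered points outside the
    core of [I]. A core point lies in no member of [NI I] but [I], so the nontrivial monotonicity
    conditions of [NI I] are [f s <= f t] for [s] in the core and [t] in [I]. *)
Lemma nested_to_one_face Delta B N : simplicial_complex Delta ->
  finset.set0 \in Delta -> B != finset.set0 ->
  building_set Delta B -> nested Delta B N ->
  exists2 NI : {set S} -> {set {set S}},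
    forall I, I \in B -> nested Delta (one_face_building I) (NI I) &
    forall f, adapted N f <-> forall I, I \in B -> adapted (NI I) f.
Proof.
move=> cD D0 /set0Pn[I0 I0B] bB nN; have [D1 _] := cD.
have [BD B1 _] := bB; have [/fintype.subsetP NB _] := nN.
pose U := finset.cover N.
have UD : U \in Delta by apply: cover_nested nN.
pose core I s := (s \in I) && [forall K in N, (s \in K) ==> (I \subset K)].
pose NI I : {set {set S}} := [set X : {set S} | (X == I) && (I \subset U)] :|:
   [set [set s] | s in [set s in U | ~~ core I s]].
have NIP I (X : {set S}) : X \in NI I -> (X = I /\ I \subset U) \/
    exists s, [/\ X = [set s], s \in U & ~~ core I s].
  move=> /finset.setUP[|/imsetP[s]]; rewrite inE => /andP[].
    by move=> /eqP; left.
  by right; exists s.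
have NII I : I \subset U -> I \in NI I by move=> IU; rewrite !inE eqxx IU.
have NI1 I s : s \in U -> ~~ core I s -> [set s] \in NI I.
  by move=> sU sc; apply/finset.setUP; right; apply/imsetP; exists s;
    rewrite ?inE ?sU.
have NIU I (X : {set S}) : X \in NI I -> X \subset U.
  by case/NIP => [[->]|[s [-> sU _]]] //; rewrite finset.sub1set.
have NIB I (X : {set S}) : X \in NI I -> X \in one_face_building I.
  case/NIP => [[-> _]|[s [-> _ _]]]; apply/setU1P; first by left.
  by right; apply/imsetP; exists s.
exists NI => [I IB|f].
  split; first by apply/fintype.subsetP => X; apply: NIB.
  move=> X XN X2 aX; have inX K : K \in X -> K \in NI I
    by apply: (fintype.subsetP XN).
  have XU : finset.cover X \subset U by apply: cover_sub => K /inX /NIU.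
  split; first exact: D1 XU.
  have other K : K \in X -> exists2 L, L \in X & L != K.
    move=> KX; have /set0Pn[L /setD1P[LK LX]] : X :\ K != finset.set0.
      by move: X2; rewrite (cardsD1 K) KX ltnS card_gt0.
    by exists L.
  apply/negP => /setU1P[XI|/imsetP[s _ Xs]].
    (* If the union is [I], the member of [X] through a core point of [I] can only be [I], which
       contains all the others. *)
    have [|s sI cs] := nested_core cD bB nN IB; first by rewrite -XI.
    have csI : core I s.
      by rewrite /core sI; apply/forall_inP => K KN; apply/implyP; apply: cs.
    move: (sI); rewrite -XI => /mem_cover[K KX sK].
    case/NIP: (inX _ KX) => [[KI _]|[s' [Ks' _]]]; last first.
      by move: sK; rewrite Ks' => /set1P <-; rewrite csI.
    have [L LX LK] := other K KX.
    by have := aX _ _ LX KX LK; rewrite KI -XI (sub_cover LX).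
  have X1 K : K \in X -> K = [set s].
    move=> KX; apply/eqP; rewrite eqEcard -{1}Xs sub_cover // cards1 card_gt0.
    case/NIP: (inX _ KX) => [[-> _]|[s' [-> _ _]]]; first by case: (BD I IB).
    by apply/set0Pn; exists s'; rewrite inE.
  have /set0Pn[K KX] : X != finset.set0 by rewrite -card_gt0 (ltn_trans _ X2).
  by have [L LX] := other K KX; rewrite (X1 L) // (X1 K) // eqxx.
have coreU I s : s \in U -> core I s -> I \subset U.
  move=> /mem_cover[K KN sK] /andP[sI /forall_inP cI].
  exact: fintype.subset_trans (implyP (cI K KN) sK) (sub_cover KN).
split=> [[f0 fN fM] I IB|fI].
  split=> // [s sNI|s t st].
    apply: fN; apply: contraNN sNI => sU; apply/mem_cover.
    case: (boolP (core I s)) => cs.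
      by exists I; [apply: NII; apply: coreU cs|case/andP: cs].
    by exists [set s]; [apply: NI1|rewrite inE].
  case: (boolP (s \in U)) => sU; last by rewrite (fN s).
  case: (boolP (core I s)) => cs; last first.
    by have /set1P -> : t \in [set s] by apply: st; [apply: NI1|apply/set1P].
  have [sI /forall_inP cI] := andP cs; apply: fM => K KN sK.
  apply: (fintype.subsetP (implyP (cI K KN) sK)).
  by apply: st => //; apply: NII; apply: coreU cs.
have fN s : s \notin U -> f s = 0.
  have [_ fN _] := fI I0 I0B; move=> sU; apply: fN; apply: contraNN sU.
  by apply: (fintype.subsetP (cover_sub (@NIU I0))).
have f0 s : 0 <= f s by have [] := fI I0 I0B.
split=> // s t st; case: (boolP (s \in U)) => sU; last by rewrite (fN s).
have /mem_cover[K0 K0N sK0] := sU.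
(* Let [M] be a smallest member of [N] through [s]. Members through [s] form a chain, so [s] is a
   core point of [M], and [f s <= f t] is a condition of [NI M]. *)
pose P K := (K \in N) && (s \in K).
have PK0 : P K0 by rewrite /P K0N.
case: (@arg_minnP _ K0 P (fun L : {set S} => #|L|) PK0) => M /andP[MN sM] minM.
have [_ _ fM] := fI M (NB _ MN); apply: fM => X XM sX.
case/NIP: XM => [[-> _]|[s' [Xs' _ /negP]]]; first exact: st.
move: sX; rewrite Xs' => /set1P <-; case.
rewrite /core sM; apply/forall_inP => K KN; apply/implyP => sK.
have [|//|KM] := nested_laminar bB nN MN KN.
  by apply/set0Pn; exists s; rewrite inE sM.
have /eqP -> // : K == M by rewrite eqEcard KM; apply: minM; rewrite /P KN.
Qed.

(* [N] consists of the members of [B] whose indicator function is adapted to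
   every [NI I]; a function adapted to all [NI I] is recovered from the
   connected components of its superlevel sets. *)
Lemma one_face_to_nested Delta B (NI : {set S} -> {set {set S}}) :
  simplicial_complex Delta ->
  finset.set0 \in Delta -> B != finset.set0 -> building_set Delta B ->
  (forall I, I \in B -> nested Delta (one_face_building I) (NI I)) ->
  exists2 N, nested Delta B N &
    forall f, adapted N f <-> forall I, I \in B -> adapted (NI I) f.
Proof.
move=> cD D0 /set0Pn[I0 I0B] bB nNI; have [D1 _] := cD.
have [BD B1 BU] := bB.
have bI I : I \in B -> building_set Delta (one_face_building I).
  by move=> IB; have [] := BD I IB; apply: one_face_buildingP.
have NID I : I \in B -> finset.cover (NI I) \in Delta.
  by move=> IB; apply: cover_nested (nNI I IB) => //; apply: bI.
pose adm L := forall I, I \in B -> L \subset finset.cover (NI I) /\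
  forall s t, s \in L -> dominated (NI I) s t -> t \in L.
pose N := [set M in B | `[< adm M >]].
have inN M : M \in N <-> M \in B /\ adm M.
  by rewrite inE; split=> [/andP[? /asboolP]|[-> /asboolP]].
exists N => [|f].
  split; first by apply/fintype.subsetP => M /inN[].
  move=> X XN X2 aX; have inX K : K \in X -> K \in B /\ adm K
    by move=> KX; apply/inN; apply: (fintype.subsetP XN).
  have XU I : I \in B -> finset.cover X \subset finset.cover (NI I).
    by move=> IB; apply: cover_sub => K /inX[_ /(_ I IB)[]].
  split; first exact: D1 (NID I0 I0B) (XU I0 I0B).
  apply/negP => WB.
  (* With the union itself as the extra face, some [s] in it lies only in members of its [NI] that
     contain the whole union. The [M] in [X] through [s] is closed under domination, so it contains
     every other member of [X]. *)
  have [|s sW cs] := nested_core cD (bI _ WB) (nNI _ WB) _ (XU _ WB).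
    by apply/setU1P; left.
  have /mem_cover[M MX sM] := sW.
  have WM : finset.cover X \subset M.
    apply/fintype.subsetP => t tW; have [_ /(_ _ WB)[_ aM]] := inX _ MX.
    by apply: aM sM _ => K KN sK; apply: (fintype.subsetP (cs K KN sK)).
  have /set0Pn[L /setD1P[LM LX]] : X :\ M != finset.set0.
    by move: X2; rewrite (cardsD1 M) MX ltnS card_gt0.
  by have /negP[] := aX _ _ LX MX LM; apply: fintype.subset_trans WM; apply: sub_cover.
split=> [[f0 fN fM] I IB|fI].
  split=> // [s sNI|s t st].
    apply: fN; apply: contraNN sNI => /mem_cover[K /inN[_ /(_ I IB)[KI _]]].
    exact: (fintype.subsetP KI).
  apply: fM => K /inN[_ /(_ I IB)[_ aK]] sK; exact: aK st.
have f0 s : 0 <= f s by have [] := fI I0 I0B.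
(* [M] is the component of [s] in the superlevel set [L]: a largest member of [B] through [s] inside
   [L]. If every member of [N] through [s] contains [t], then so does [M], whence [f s <= f t]. *)
have key s : 0 < f s -> exists2 M, M \in N & s \in M /\
    forall t, t \in M -> f s <= f t.
  move=> fs; pose L := [set t | f s <= f t].
  have LU I : I \in B -> L \subset finset.cover (NI I).
    move=> IB; apply/fintype.subsetP => t; rewrite inE => st.
    have [_ fN _] := fI I IB; apply: contrapT => /negP /fN ft.
    by move: st; rewrite ft leNgt fs.
  have LD : L \in Delta by apply: D1 (NID _ I0B) (LU _ I0B).
  pose P M := [&& M \in B, s \in M & M \subset L].
  have Ps : P [set s] by rewrite /P B1 !inE eqxx finset.sub1set inE lexx.
  case: (@arg_maxnP _ [set s] P (fun L : {set S} => #|L|) Ps).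
  move=> M /and3P[MB sM ML] maxM; exists M; last first.
    by split=> // t /(fintype.subsetP ML); rewrite inE.
  apply/inN; split=> // I IB; split; first exact: fintype.subset_trans (LU I IB).
  move=> r t rM rt; case: (eqVneq r t) => [<-//|nrt].
  have rL := fintype.subsetP ML _ rM.
  (* A singleton through [r] would miss [t], so only [I] contains [r]. Then [f r] is minimal on [I],
     so [I] lies in [L], and maximality absorbs it into [M]. *)
  have onlyI K : K \in NI I -> r \in K -> K = I.
    move=> KN rK; have [NIB _] := nNI I IB.
    have /setU1P[//|/imsetP[r' _ Kr]] := fintype.subsetP NIB K KN.
    have tK := rt K KN rK; move: tK rK nrt; rewrite Kr => /set1P -> /set1P ->.
    by rewrite eqxx.
  have [rI tI] : r \in I /\ t \in I.
    have /mem_cover[K KN rK] := fintype.subsetP (LU I IB) _ rL.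
    by rewrite -(onlyI K KN rK); split=> //; apply: rt.
  have IL : I \subset L.
    apply/fintype.subsetP => u uI; have [_ _ fM] := fI I IB.
    move: rL; rewrite !inE => /le_trans; apply; apply: fM => K KN rK.
    by rewrite (onlyI K KN rK).
  have MIL : M :|: I \subset L by rewrite finset.subUset ML.
  have PMI : P (M :|: I).
    rewrite /P MIL andbT inE sM andbT BU //; last exact: D1 MIL.
    by apply/set0Pn; exists r; rewrite inE rM.
  have /eqP -> : M == M :|: I by rewrite eqEcard finset.subsetUl; exact: maxM.
  by rewrite inE tI orbT.
have fpos s : f s = 0 \/ 0 < f s.
  by have := f0 s; rewrite le_eqVlt => /orP[/eqP<-|]; [left|right].
split=> // [s sN|s t st]; case: (fpos s) => [-> //|/key[M MN [sM fM]]].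
  by case/mem_cover: sN; exists M.
by apply: fM; apply: st.
Qed.

End Coordinates.

(** * Cones in terms of coordinates *)

Section Vectors.
Context {S : finType} {R : realType} {E : lmodType R}.
Implicit Types (Delta B N : {set {set S}}) (I J K : {set S}).
Implicit Types (f g : S -> R) (v : S -> E).

Definition comb v f : E := \sum_s f s *: v s.

(** [cone] allows repeated generators; adding up the coefficients at the same index leaves one per
    index. *)
Lemma coneP (T : finType) (A : {set T}) (e : T -> E) (w : E) :
  cone [set e k | k in [set` A]]%classic w <->
  exists2 a : T -> R, forall k, 0 <= a k & w = \sum_(k in A) a k *: e k.
Proof.
split=> [[n [c [x [c0 xA ->]]]]|[a a0 ->]].
  have /boolp.choice[k kP] i : exists k, k \in A /\ e k = x i.
    by have [k kA ek] := xA i; exists k.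
  exists (fun t => \sum_(i < n | k i == t) c i) => [t|].
    exact: sumr_ge0.
  rewrite (partition_big k (mem A)) /=; last by move=> i _; case: (kP i).
  apply: eq_bigr => t _; rewrite scaler_suml; apply: eq_bigr => i /eqP <-.
  by case: (kP i) => _ ->.
exists #|A|, (fun i => a (enum_val i)), (fun i => e (enum_val i)).
split=> [i|i|]; first exact: a0.
  by exists (enum_val i) => //=; apply: enum_valP.
by rewrite big_enum_val.
Qed.

(** Exchanging sums turns a combination of the generators into [comb] of a sum of indicators;
    [laminar_adapted_sum] recovers the coefficients from an adapted [f]. *)
Lemma nested_coneP v N (w : E) : laminar N ->
  nested_cone v N w <-> exists2 f : S -> R, adapted N f & w = comb v f.
Proof.
move=> lN.
have sumE (a : {set S} -> R) : \sum_(K in N) a K *: \sum_(s in K) v s =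
    comb v (fun s => \sum_(K in N) a K *+ (s \in K)).
  rewrite /comb; under [RHS]eq_bigr do rewrite scaler_suml.
  rewrite exchange_big /=; apply: eq_bigr => K _.
  rewrite scaler_sumr big_mkcond /=; apply: eq_bigr => s _.
  by case: ifP => _; rewrite ?mulr1n // mulr0n scale0r.
split=> [/coneP[a a0 ->]|[f fN ->]].
  by exists (fun s => \sum_(K in N) a K *+ (s \in K));
    [apply: adapted_sum|apply: sumE].
have [a a0 fa] := laminar_adapted_sum lN fN.
apply/coneP; exists a => //; rewrite sumE; apply: eq_bigr => s _.
by rewrite fa.
Qed.

Lemma face_cone_comb v I f : (forall s, 0 <= f s) ->
  (forall s, s \notin I -> f s = 0) -> face_cone v I (comb v f).
Proof.
move=> f0 fI; apply/coneP; exists f => //.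
rewrite [RHS]big_mkcond; apply: eq_bigr => s _.
by case: ifPn => // /fI ->; rewrite scale0r.
Qed.

(* The transition matrix from [v] to a basis of the span is square and
   row-free, hence invertible. *)
Lemma face_cone_indep v I f : has_dim (face_cone v I) #|I| ->
  (forall s, s \notin I -> f s = 0) -> comb v f = 0 -> forall s, f s = 0.
Proof.
move=> [b [bI spanE]] fI f0 s; case: (boolP (s \in I)) => [sI|/fI //].
have /boolp.choice[A bA] i :
    exists a : 'I_#|I| -> R, b i = \sum_j a j *: v (enum_val j).
  have : lspan (face_cone v I) (b i).
    rewrite -spanE; exists 1, (fun=> 1), (fun=> b i).
    by split=> [_|]; [exists i|rewrite big_ord1 scale1r].
  move=> [n [c [x [xI ->]]]].
  have /boolp.choice[a xa] k :
      exists a : S -> R, x k = \sum_(t in I) a t *: v t.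
    by have /coneP[a _ ->] := xI k; exists a.
  exists (fun j => \sum_(k < n) c k * a k (enum_val j)).
  under [RHS]eq_bigr do rewrite scaler_suml.
  rewrite exchange_big /=; apply: eq_bigr => k _.
  rewrite xa scaler_sumr big_enum_val /=; apply: eq_bigr => j _.
  by rewrite scalerA.
pose M : 'M[R]_#|I| := \matrix_(i, j) A i j.
have Mu : M \in unitmx.
  (* A vector in the left kernel of [M] is a linear relation among the [b i]. *)
  rewrite -row_free_unit; apply: contrapT => /negP.
  rewrite -kermx_eq0 => /rowV0Pn[u /sub_kermxP uM /eqP]; apply.
  apply/rowP => i; rewrite mxE; apply: (bI (fun i => u 0 i)).
  under eq_bigr do rewrite bA scaler_sumr.
  rewrite exchange_big /= big1 // => j _.
  under eq_bigr do rewrite scalerA.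
  rewrite -scaler_suml; have /rowP/(_ j) := uM; rewrite !mxE.
  by under eq_bigr do rewrite mxE; move=> ->; rewrite scale0r.
pose c : 'rV[R]_#|I| := \row_j f (enum_val j).
have vb j : v (enum_val j) = \sum_i (invmx M) j i *: b i.
  under eq_bigr do rewrite bA scaler_sumr.
  rewrite exchange_big /= (bigD1 j) //= [X in _ + X]big1 => [|k kj].
    under eq_bigr do rewrite scalerA.
    rewrite -scaler_suml addr0; have /matrixP/(_ j j) := mulVmx Mu.
    by rewrite !mxE eqxx; under eq_bigr do rewrite mxE; move=> ->;
      rewrite scale1r.
  under eq_bigr do rewrite scalerA.
  rewrite -scaler_suml; have /matrixP/(_ j k) := mulVmx Mu.
  rewrite !mxE eq_sym (negbTE kj); under eq_bigr do rewrite mxE.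
  by move=> ->; rewrite scale0r.
(* [c *m invmx M] is the coordinate row of [comb v f] in the basis [b]. *)
have cM : c *m invmx M = 0.
  apply/rowP => i; rewrite !mxE; apply: (bI (fun i => \sum_j c 0 j * invmx M j i)).
  rewrite -[RHS]f0.
  under eq_bigr do rewrite scaler_suml.
  rewrite exchange_big /= /comb [RHS](bigID (mem I)) /= [X in _ + X]big1.
    rewrite addr0 [RHS]big_enum_val; apply: eq_bigr => j _.
    rewrite vb scaler_sumr; apply: eq_bigr => k _.
    by rewrite scalerA mxE.
  by move=> t /fI ->; rewrite scale0r.
have c0 : c = 0 by rewrite -(mulmxKV Mu c) cM mul0mx.
have /rowP/(_ (enum_rank_in sI s)) := c0.
by rewrite !mxE enum_rankK_in.
Qed.

(** The common point lies in both face cones, hence in that of [I :&: J], which gives it coordinates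
    [h'] supported there. Linear independence over [I] and over [J] identifies both [f] and [g] with
    [h']. *)
Lemma comb_inj Delta v I J f g : nondegenerate_family Delta v ->
  I \in Delta -> (forall s, 0 <= f s) -> (forall s, s \notin I -> f s = 0) ->
  J \in Delta -> (forall s, 0 <= g s) -> (forall s, s \notin J -> g s = 0) ->
  comb v f = comb v g -> f = g.
Proof.
move=> [vI vdim] ID f0 fI JD g0 gJ fg.
have : face_cone v (I :&: J) (comb v f).
  by rewrite -vI //; split; [|rewrite fg]; apply: face_cone_comb.
move=> /coneP[h h0 fh].
pose h' s := if s \in I :&: J then h s else 0.
have h'E : comb v f = comb v h'.
  rewrite fh big_mkcond; apply: eq_bigr => s _.
  by rewrite /h'; case: ifP => // _; rewrite scale0r.
have eqh K k : K \in Delta -> (forall s, s \notin K -> k s = 0) ->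
    I :&: J \subset K -> comb v k = comb v h' -> k = h'.
  move=> KD kK IJK kh; apply/funext => s; apply/eqP; rewrite -subr_eq0.
  apply/eqP; apply: (face_cone_indep (f := fun s => k s - h' s) (vdim K KD)).
    move=> t tK; rewrite kK // /h' ifN ?subr0 //.
    by apply: contraNN tK; apply: (fintype.subsetP IJK).
  rewrite /comb; under eq_bigr do rewrite scalerBl.
  by rewrite sumrB; apply/eqP; rewrite subr_eq0; apply/eqP.
rewrite (eqh I f) ?finset.subsetIl //.
by rewrite -(eqh J g) ?finset.subsetIr // -fg.
Qed.

(** Each cone supplies its own coordinates for [w]; by [comb_inj] they all agree, so a single [f]
    serves every [I]. *)
Lemma bigcap_nested_coneP Delta B v (NI : {set S} -> {set {set S}}) (w : E) :
  nondegenerate_family Delta v -> B != finset.set0 ->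
  (forall I, I \in B -> laminar (NI I) /\ finset.cover (NI I) \in Delta) ->
  (\bigcap_(I in [set` B]) nested_cone v (NI I))%classic w <->
  exists2 f : S -> R, (forall I, I \in B -> adapted (NI I) f) & w = comb v f.
Proof.
move=> hv /set0Pn[I0 I0B] hN; split=> [wN|[f fN wf] I /= IB]; last first.
  have [lN _] := hN I IB.
  by apply/(nested_coneP _ _ lN); exists f; [apply: fN|].
have [l0 c0] := hN I0 I0B.
have /(nested_coneP _ _ l0)[f f0 wf] := wN I0 I0B.
exists f => // I IB; have [lI cI] := hN I IB.
have /(nested_coneP _ _ lI)[g gI wg] := wN I IB.
have [[fp fs _] [gp gs _]] := (f0, gI).
have -> // : f = g.
by apply: (comb_inj hv c0 fp fs cI gp gs); rewrite -wf.
Qed.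

End Vectors.

(** * Equality of the fan with the common refinement *)

Theorem theorem3p4p4 (R : realType) (E : lmodType R) (S : finType)
    (Delta : {set {set S}}) (v : S -> E) (B : {set {set S}})
    (hS : (0 < #|S|)%N)
    (hDelta : simplicial_complex Delta)
    (hv : nondegenerate_family Delta v)
    (hB : building_set Delta B) :
  nested_fan Delta v B =
  coarsest_common_refinement B
    (fun I : {set S} => nested_fan Delta v (one_face_building I)).
Proof.
(* A point of [S] provides the empty face and makes [B] nonempty, so that the intersection over [B]
   is not an empty one. *)
have /card_gt0P[s _] := hS.
have [BD B1 _] := hB; have [D1 D2] := hDelta.
have D0 : finset.set0 \in Delta by apply: D1 (D2 s) (finset.sub0set _).
have B0 : B != finset.set0 by apply/set0Pn; exists [set s]%SET.
have good (NI : {set S} -> {set {set S}}) :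
    (forall I, I \in B -> nested Delta (one_face_building I) (NI I)) ->
    forall I, I \in B -> laminar (NI I) /\ finset.cover (NI I) \in Delta.
  move=> nNI I IB; have [I0 ID] := BD I IB.
  have bI := one_face_buildingP hDelta I0 ID.
  by split; [apply: nested_laminar bI (nNI I IB)
            |apply: cover_nested D0 bI (nNI I IB)].
(* Both sides are images under [comb] of sets of coordinate functions, and the third premise
   identifies these sets. *)
have eqD N NI : nested Delta B N ->
    (forall I, I \in B -> nested Delta (one_face_building I) (NI I)) ->
    (forall f : S -> R,
      adapted N f <-> forall I, I \in B -> adapted (NI I) f) ->
    nested_cone v N = (\bigcap_(I in [set` B]) nested_cone v (NI I))%classic.
  move=> nN nNI fE; have lN := nested_laminar hB nN.
  apply/seteqP; split=> w.
    move=> /(nested_coneP _ _ lN)[f /fE fN ->].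
    by apply/(bigcap_nested_coneP _ hv B0 (good _ nNI)); exists f.
  move=> /(bigcap_nested_coneP _ hv B0 (good _ nNI))[f /fE fN ->].
  by apply/(nested_coneP _ _ lN); exists f.
apply/seteqP; split=> D.
  move=> [N nN <-].
  have [NI nNI fE] := nested_to_one_face (R := R) hDelta D0 B0 hB nN.
  exists (fun I => nested_cone v (NI I)); split; last exact: eqD.
  by move=> I IB; exists (NI I) => //; apply: nNI.
move=> [C [CF ->]].
(* The choice ranges over all sets [I]; outside [B], where nothing is required, the empty family
   stands in. *)
have /boolp.choice[NI nNI] I : exists N, I \in B ->
    nested Delta (one_face_building I) N /\ nested_cone v N = C I.
  case: (boolP (I \in B)) => [/CF[N nN NC]|_]; first by exists N.
  by exists finset.set0.
have nNI' I : I \in B -> nested Delta (one_face_building I) (NI I)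
  by move=> /nNI[].
have [N nN fE] := one_face_to_nested (R := R) hDelta D0 B0 hB nNI'.
exists N => //; rewrite (eqD N NI) //; apply: eq_bigcapr => I IB.
by case: (nNI I IB).
Qed.
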